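(* There is an absolute constant $C>0$ such that the following holds. Let $\Gamma$ be a finite Abelian group with $|\Gamma| = n$, let $S$ be a symmetric multiset of elements of $\Gamma$ with $|S| = d$, and let $G = \mathrm{Cay}(\Gamma, S)$ be connected (so $\lambda_2(G) > 0$). Then for every $\tau$ with $\lambda_2(G) \le \tau \le 3/2$, $$\mathrm{mul}_\tau(G) \le \left(C\,\frac{\tau}{\lambda_2(G)}\right)^{20 d}.$$
   Context: A multiset $S$ of elements of an Abelian group $\Gamma$ is symmetric if for every $x\in\Gamma$ the multiplicities of $x$ and $-x$ in $S$ are equal. $\mathrm{Cay}(\Gamma,S)$ has vertex set $\Gamma$ and an edge $(v,v+s)$ for every $v\in\Gamma$ and every element $s$ of $S$ (with multiplicity); it is $d$-regular. For a graph $G$ on $n$ vertices with normalized adjacency matrix $\mathbf{A}$ (entries $\mathbf{A}_{ij} = (\text{number of edges between } i,j)/\sqrt{\deg(i)\deg(j)}$), the normalized Laplacian is $\mathbf{L} = I - \mathbf{A}$, with eigenvalues $0 = \lambda_1(G) \le \lambda_2(G) \le \dots \le \lambda_n(G) \le 2$. The $\tau$-threshold rank is $\mathrm{mul}_\tau(G) = |\{i : \lambda_i(G) \le \tau\}|$. *)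

(* Defs.v *)
From HB Require Import structures.
From mathcomp Require Import all_boot all_order all_algebra.
From mathcomp Require Import polyrcf.
From mathcomp Require Import reals.
Set Implicit Arguments. Unset Strict Implicit. Unset Printing Implicit Defensive.
Import Order.TTheory GRing.Theory Num.Theory.
Local Open Scope ring_scope.

(* A multiset of elements of Gamma is a sequence (order irrelevant,
   multiplicities given by count_mem). *)
Definition symmetric_multiset (Gamma : finZmodType) (S : seq Gamma) : Prop :=
  forall x : Gamma, count_mem x S = count_mem (- x) S.

Definition cay_edges (Gamma : finZmodType) (S : seq Gamma) (u v : Gamma) : nat :=
  count_mem (v - u) S.

Definition cay_rel (Gamma : finZmodType) (S : seq Gamma) : rel Gamma :=
  fun u v => (0 < cay_edges S u v)%N.

Definition cay_connected (Gamma : finZmodType) (S : seq Gamma) : Prop :=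
  forall u v : Gamma, connect (cay_rel S) u v.

Definition cay_deg (Gamma : finZmodType) (S : seq Gamma) (u : Gamma) : nat :=
  \sum_(v : Gamma) cay_edges S u v.

Definition cay_normadj (R : rcfType) (Gamma : finZmodType) (S : seq Gamma)
  : 'M[R]_#|Gamma| :=
  \matrix_(i, j)
    ((cay_edges S (enum_val i) (enum_val j))%:R /
      Num.sqrt ((cay_deg S (enum_val i))%:R * (cay_deg S (enum_val j))%:R)).

Definition cay_normlap (R : rcfType) (Gamma : finZmodType) (S : seq Gamma)
  : 'M[R]_#|Gamma| := 1%:M - cay_normadj R S.

(* Real eigenvalues of a square matrix, counted with (algebraic) multiplicity,
   in nondecreasing order: the real roots of the characteristic polynomial,
   each repeated according to its multiplicity.  For a real symmetric matrix
   (such as the normalized Laplacian) these are all of its eigenvalues. *)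
Definition eigenvalues (R : rcfType) (n : nat) (M : 'M[R]_n) : seq R :=
  let p := char_poly M in
  flatten [seq nseq (mup r p) r | r <- rootsR p].

(* lambda_k(G), 1-indexed *)
Definition lambda (R : rcfType) (Gamma : finZmodType) (S : seq Gamma) (k : nat) : R :=
  nth 0 (eigenvalues (cay_normlap R S)) k.-1.

Definition mul_tau (R : rcfType) (Gamma : finZmodType) (S : seq Gamma) (tau : R) : nat :=
  count (fun x => x <= tau) (eigenvalues (cay_normlap R S)).

Arguments cay_normadj R {Gamma} S.
Arguments cay_normlap R {Gamma} S.
Arguments lambda R {Gamma} S k.
Arguments mul_tau R {Gamma} S tau.

(* Main.v *)
(** Over the complex numbers the translations by the elements of [Gamma] are
    simultaneously diagonalized by the characters, so the eigenvalues of the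
    Laplacian are [lambda_X = (1/d) sum_(s in S) (1 - Re X(s))].  Since
    [|X(s) - Y(s)|^2 = 2 (1 - Re (X Y^-1)(s))], the map [X |-> (X(s))_(s in S)]
    to [R^(2d)] sends the characters with [lambda_X <= tau] into the ball of
    squared radius [2 d tau] around [(1, ..., 1)], and distinct characters to
    points at squared distance at least [2 d lambda_2], because [X Y^-1] is
    then a nontrivial character.  Rescaling by [lambda_2], such a set lies in
    distinct cells of the unit grid, and at most [(24 tau / lambda_2)^(2d)]
    cells are close enough to the center. *)
Require Import Defs.
From HB Require Import structures.
From mathcomp Require Import all_boot all_order all_algebra.
From mathcomp Require Import fingroup cyclic spectral.
From mathcomp Require Import polyrcf complex.
From mathcomp Require Import reals.
From mathcomp Require Import ring lra zify.
Import Order.TTheory GRing.Theory Num.Theory.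
Local Open Scope ring_scope.

(** * Counting bounded integer vectors and separated points in a ball *)

Lemma geometric_sum_le {F : realFieldType} (x : F) (n : nat) :
  0 <= x < 1 -> \sum_(j < n) x ^+ j <= (1 - x)^-1.
Proof.
case/andP=> x0 x1.
have y0 : 0 < 1 - x by rewrite subr_gt0.
rewrite -[leRHS]mul1r ler_pdivlMr // mulrC.
have -> : (1 - x) * (\sum_(j < n) x ^+ j) = 1 - x ^+ n.
  by rewrite -[1 - x ^+ n]opprB subrX1 -mulNr opprB.
by rewrite gerBl exprn_ge0.
Qed.

(** Bernoulli's inequality [1 - n y <= (1 - y)^n] at [n = K], [y = 1/(2K)]. Raised to the power
    [#|I|], it bounds the weight of a counted vector from below. *)
Lemma bernoulli_half {F : realFieldType} (K : nat) :
  (0 < K)%N -> 2^-1 <= (1 - ((2 * K)%N%:R)^-1) ^+ K :> F.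
Proof.
move=> K0; set y := ((2 * K)%N%:R)^-1.
have K0' : 0 < K%:R :> F by rewrite ltr0n.
have yE : K%:R * y = 2^-1 :> F.
  by rewrite /y natrM invfM mulrCA divff ?mulr1 // gt_eqF.
have y0 : 0 <= y by rewrite invr_ge0.
have y1 : y <= 1.
  by rewrite invf_le1 ?ltr0n ?ler1n; lia.
have bern n : 1 - n%:R * y <= (1 - y) ^+ n.
  elim: n => [|n IH]; first by rewrite mul0r subr0.
  rewrite exprS -natr1.
  apply: le_trans (ler_wpM2l _ IH); last by rewrite subr_ge0.
  have : 0 <= n%:R * y * y by rewrite !mulr_ge0.
  lra.
by apply: le_trans (bern K); rewrite yE; lra.
Qed.

(* Weight a vector g by x ^ (sum of g) with x = 1 - 1/(2K): each vector counted
   weighs at least 2 ^ - #|I|, and the total weight is at most (2K) ^ #|I|. *)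
Lemma card_bounded_sum (T I : finType) (A : {set T}) (f : T -> I -> nat)
    (K : nat) :
  (0 < K)%N ->
  {in A &, forall t u, f t =1 f u -> t = u} ->
  {in A, forall t, \sum_i f t i <= #|I| * K}%N ->
  (#|A| <= (4 * K) ^ #|I|)%N.
Proof.
move=> K0 finj fsum.
(* Each entry is at most the whole sum, so the vectors live in a finite function type, over which
   sums of products can be distributed. *)
pose B := (#|I| * K)%N.
pose phi t := [ffun i => inord (f t i) : 'I_B.+1].
have fB t i : t \in A -> (f t i < B.+1)%N.
  move=> /fsum; rewrite ltnS; apply: leq_trans.
  by rewrite (bigD1 i) //= leq_addr.
have phiE t i : t \in A -> phi t i = f t i :> nat.
  by move=> tA; rewrite ffunE inordK // fB.
have phi_inj : {in A &, injective phi}.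
  move=> t u tA uA /ffunP e; apply: finj => // i.
  by rewrite -!phiE // e.
pose x : rat := 1 - ((2 * K)%N%:R)^-1.
have x0 : 0 <= x < 1.
  rewrite /x subr_ge0 invf_le1 ?ltr0n ?ler1n; try lia.
  by rewrite gtrBl invr_gt0 ltr0n; lia.
have [x_ge0 x_lt1] := andP x0.
have up : \sum_(t in A) \prod_i x ^+ f t i <= (2 * K)%N%:R ^+ #|I|.
  have -> : \sum_(t in A) \prod_i x ^+ f t i =
            \sum_(g in phi @: A) \prod_i x ^+ g i.
    rewrite big_imset //=; apply: eq_bigr => t tA.
    by apply: eq_bigr => i _; rewrite phiE.
  apply: (@le_trans _ _ (\sum_(g : {ffun I -> 'I_B.+1}) \prod_i x ^+ g i)).
    rewrite big_mkcond; apply: ler_sum => g _; case: ifP => // _.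
    by apply: prodr_ge0 => i _; rewrite exprn_ge0.
  (* The total weight factors into [#|I|] truncated geometric series, each at most
     [1 / (1 - x) = 2K]. *)
  rewrite -(bigA_distr_bigA (fun (i : I) (j : 'I_B.+1) => x ^+ j)) /=.
  have geo : \sum_(j < B.+1) x ^+ j <= (2 * K)%N%:R.
    by apply: le_trans (geometric_sum_le x _ x0) _; rewrite /x subKr invrK.
  rewrite prodr_const.
  have geo_ge0 : 0 <= \sum_(j < B.+1) x ^+ j.
    by rewrite sumr_ge0 // => j _; rewrite exprn_ge0.
  rewrite lerXn2r // ?nnegrE //.
have lo : #|A|%:R * 2^-1 ^+ #|I| <= \sum_(t in A) \prod_i x ^+ f t i.
  rewrite mulr_natl -sumr_const; apply: ler_sum => t tA.
  rewrite -expr_sum.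
  apply: (@le_trans _ _ (x ^+ (#|I| * K))).
    rewrite mulnC exprM lerXn2r ?nnegrE ?exprn_ge0 ?invr_ge0 //.
    exact: bernoulli_half.
  by apply: ler_wiXn2l; [exact: x_ge0 | exact: ltW | exact: fsum].
have := le_trans lo up.
rewrite exprVn ler_pdivrMr ?exprn_gt0 // -exprMn -natrM -natrX ler_nat.
by rewrite mulnC mulnA.
Qed.

(** Cells are numbered by naturals, as [card_bounded_sum] requires. The parity records the sign;
    without it truncation toward zero would merge the two cells next to 0 into one of width 2. *)
Definition grid_code {R : realType} (x : R) : nat :=
  if 0 <= x then (Num.truncn x).*2 else (Num.truncn (- x)).*2.+1.

(** The code is at most [2|x| + 1], and [2|x| <= x^2 + 1]. A bound in [x^2] lets the Euclidean norm
    control the sum of the codes. *)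
Lemma grid_code_le {R : realType} (x : R) : (grid_code x)%:R <= x ^+ 2 + 2.
Proof.
rewrite /grid_code; case: (lerP 0 x) => x0.
  have := truncn_le x; rewrite x0 -muln2 natrM.
  have := sqr_ge0 (x - 1); rewrite sqrrB1; lra.
have nx0 : 0 <= - x by rewrite oppr_ge0 ltW.
have := truncn_le (- x); rewrite nx0 -natr1 -muln2 natrM.
have := sqr_ge0 (x + 1); rewrite sqrrD1; lra.
Qed.

Lemma grid_code_close {R : realType} (x y : R) :
  grid_code x = grid_code y -> (x - y) ^+ 2 < 1.
Proof.
suff aux (a b : R) : 0 <= a -> 0 <= b -> Num.truncn a = Num.truncn b ->
    (a - b) ^+ 2 < 1.
  rewrite /grid_code; case: (lerP 0 x) => x0; case: (lerP 0 y) => y0 e.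
  - by apply: aux => //; lia.
  - by exfalso; lia.
  - by exfalso; lia.
  - have -> : (x - y) ^+ 2 = (- x - - y) ^+ 2 by ring.
    by apply: aux; try lia; rewrite oppr_ge0 ltW.
move=> a0 b0 e.
have /andP [a1 a2] := truncn_itv a0; have /andP [b1 b2] := truncn_itv b0.
rewrite -e in b1 b2.
have a3 : a - b < 1 by move: a2 b1; rewrite -natr1; lra.
have b3 : b - a < 1 by move: b2 a1; rewrite -natr1; lra.
nra.
Qed.

(* Points in a common cell of the unit grid are at squared distance less than
   #|I|, so distinct points have distinct codes. *)
Lemma card_separated_le {R : realType} (T I : finType) (A : {set T})
    (x : T -> I -> R) (q : R) :
  (0 < #|I|)%N -> 1 <= q ->
  {in A, forall t, \sum_i x t i ^+ 2 <= #|I|%:R * q} ->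
  {in A &, forall t u, t != u -> #|I|%:R <= \sum_i (x t i - x u i) ^+ 2} ->
  #|A|%:R <= (24 * q) ^+ #|I|.
Proof.
move=> I0 q1 xq xsep.
(* The codes sum to at most [#|I| (q + 2)], so [K] must be at least [q + 2]; and [K <= 6q] turns
   [4K] into the constant 24. *)
pose K := (Num.truncn q + 3)%N.
have Kq : K%:R <= 6 * q.
  have := truncn_le q; rewrite (le_trans ler01 q1) /K natrD; lra.
have qK : q + 2 <= K%:R.
  have := truncnS_gt q; rewrite /K natrD -natr1; lra.
apply: (@le_trans _ _ ((4 * K) ^ #|I|)%N%:R).
  rewrite ler_nat; apply: (@card_bounded_sum _ _ _ (fun t i => grid_code (x t i))).
  - by rewrite /K addn3.
  - move=> t u tA uA e; apply: contraTeq isT => /(xsep _ _ tA uA).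
    rewrite leNgt -{1}(mulr1 #|I|%:R) mulr_natl -sumr_const => /negP [].
    (* A sum of strict inequalities is strict only if it has a term. *)
    have [i0 _] : exists i0, i0 \in I by exact/card_gt0P.
    rewrite (bigD1 i0) // [ltRHS](bigD1 i0) //=.
    apply: ltr_leD; first exact/grid_code_close/e.
    by apply: ler_sum => i _; apply/ltW/grid_code_close/e.
  - move=> t tA; rewrite -(ler_nat R) natr_sum natrM.
    apply: (@le_trans _ _ (\sum_i (x t i ^+ 2 + 2))).
      by apply: ler_sum => i _; exact: grid_code_le.
    rewrite big_split /= sumr_const -[2 *+ _]mulr_natl.
    apply: (@le_trans _ _ (#|I|%:R * (q + 2))).
      by rewrite [leRHS]mulrDr lerD2r; exact: xq.
    by rewrite ler_wpM2l.
rewrite natrX lerXn2r ?nnegrE //; last by rewrite natrM; lra.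
by rewrite mulr_ge0 // (le_trans ler01).
Qed.

(** * Eigenvalue lists and characteristic polynomials *)

Lemma char_poly_conj {F : fieldType} {n} (P A B : 'M[F]_n) :
  P \in unitmx -> P *m A = B *m P -> char_poly A = char_poly B.
Proof.
move=> Pu e; rewrite /char_poly.
have detP : \det (map_mx polyC P) != 0.
  by rewrite det_map_mx polyC_eq0 -unitfE -unitmxE.
apply: (mulfI detP); rewrite [RHS]mulrC -!det_mulmx; congr (\det _).
rewrite /char_poly_mx mulmxBr mulmxBl -!map_mxM e; congr (_ - _).
by rewrite mul_mx_scalar mul_scalar_mx.
Qed.

(** Since [rootsR] has no duplicates, a root occurs exactly as often as its multiplicity, which for
    a product of linear factors is its count in [s]. *)
Lemma eigenvalues_perm {R : rcfType} {n} (M : 'M[R]_n) (s : seq R) :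
  char_poly M = \prod_(x <- s) ('X - x%:P) -> perm_eq (eigenvalues M) s.
Proof.
move=> Mp; rewrite /eigenvalues.
set p := char_poly M.
have p0 : p != 0 by exact/monic_neq0/char_poly_monic.
have rootE x : (x \in rootsR p) = root p x.
  by rewrite -roots_on_rootsR // in_itv.
have cnt (r : seq R) x : uniq r ->
    count_mem x (flatten [seq nseq (mup y p) y | y <- r]) =
    ((x \in r) * mup x p)%N.
  elim: r => //= y r IH /andP [yr ur].
  rewrite count_cat count_nseq IH // in_cons /= [x == y]eq_sym.
  by have [<-|] := eqVneq y x; rewrite ?(negbTE yr) ?mul0n ?addn0.
apply/allP => x _ /=; apply/eqP; rewrite cnt; last exact: uniq_roots.
rewrite rootE {2}/p Mp mu_prod_XsubC.
case: (boolP (root p x)) => [_|]; first by rewrite mul1n.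
rewrite /p Mp root_prod_XsubC mul0n => /count_memPn -> //.
Qed.

Lemma eigenvalues_sorted {R : rcfType} {n} (M : 'M[R]_n) :
  sorted <=%R (eigenvalues M).
Proof.
rewrite /eigenvalues; set p := char_poly M.
have : sorted <%R (rootsR p) by exact: sorted_roots.
elim: (rootsR p) => //= y r IH yr.
have {IH} := IH (path_sorted yr).
set t := flatten _ => ts.
have yt : all (fun z => y <= z) t.
  apply/allP => z /flattenP [w /mapP [u ur ->]].
  rewrite mem_nseq => /andP [_ /eqP ->].
  by apply: ltW; move/(order_path_min lt_trans)/allP: yr; apply.
elim: (mup y p) => //= k IH.
rewrite path_min_sorted //; apply/allP => z; rewrite mem_cat => /orP [].
  by rewrite mem_nseq => /andP [_ /eqP ->] /=.
by move/(allP yt).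
Qed.

(** With the single zero in front, position 1 of the sorted spectrum, which is where [lambda] looks
    for index 2, holds the least positive eigenvalue. *)
Lemma sorted_cons_nth1 {R : rcfType} (e s : seq R) :
  sorted <=%R e -> perm_eq e (0 :: s) -> all (> 0) s -> s != [::] ->
  nth 0 e 1 \in s /\ {in s, forall x, nth 0 e 1 <= x}.
Proof.
move=> es eps s_gt0 s0.
have e_eq : e = 0 :: sort <=%R s.
  apply: (sorted_eq le_trans le_anti) => //; last first.
    by apply: perm_trans eps _; rewrite perm_cons perm_sym perm_sort.
  rewrite /= path_min_sorted; first exact/sort_sorted/le_total.
  by apply/allP => x; rewrite mem_sort => /(allP s_gt0)/ltW.
rewrite e_eq /=.
have := sort_sorted (@le_total _ R) s; have := mem_sort <=%R s.
case: (sort _ s) (size_sort <=%R s) => [|a t] /=.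
  by case: (s) s0.
move=> _ ms at_sorted; rewrite -ms mem_head; split=> // x.
rewrite -ms in_cons => /orP [/eqP -> //|].
exact/allP/(order_path_min le_trans).
Qed.

(** * Translations and characters of a finite Abelian group *)

Definition translation_mx (F : fieldType) {G : finZmodType} (g : G)
  : 'M[F]_#|G| := \matrix_(i, j) (enum_val j == enum_val i + g)%:R.

Lemma mul_translation_mx {F : fieldType} {G : finZmodType} {m}
    (M : 'M[F]_(m, #|G|)) (g : G) i j :
  (M *m translation_mx F g) i j = M i (enum_rank (enum_val j - g)).
Proof.
rewrite mxE (bigD1 (enum_rank (enum_val j - g))) //= big1 ?addr0.
  by rewrite mxE enum_rankK subrK eqxx mulr1.
move=> k kj; rewrite mxE; case: eqP => [e|_]; last by rewrite mulr0.
by move: kj; rewrite e addrK enum_valK eqxx.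
Qed.

Lemma translation_mxD {F : fieldType} {G : finZmodType} (g h : G) :
  translation_mx F g *m translation_mx F h = translation_mx F (g + h).
Proof.
apply/matrixP => i j; rewrite mul_translation_mx !mxE enum_rankK.
by rewrite subr_eq addrA.
Qed.

(** The adjoint of the translation by [g] is the translation by [- g], and translations commute. *)
Lemma translation_mx_normal {C : numClosedFieldType} {G : finZmodType} (g : G) :
  translation_mx C g \is normalmx.
Proof.
have adj : map_mx Num.conj (translation_mx C g)^T = translation_mx C (- g).
  apply/matrixP => i j; rewrite !mxE conjC_nat.
  by rewrite -subr_eq eq_sym.
by apply/normalmxP; rewrite adj !translation_mxD addrC.
Qed.

(** Each translation is diagonalizable by the spectral theorem, and a commuting family of
    diagonalizable matrices has a common diagonalizing basis. *)
Lemma translation_mx_codiagonalizable (C : numClosedFieldType)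
    (G : finZmodType) :
  exists (P : 'M[C]_#|G|) (chi : 'I_#|G| -> G -> C), P \in unitmx /\
    forall g, P *m translation_mx C g = diag_mx (\row_i chi i g) *m P.
Proof.
have [cd _] := codiagonalizableP [seq translation_mx C g | g : G].
case: cd.
  split=> [A B /mapP [g _ ->] /mapP [h _ ->]|A /mapP [g _ ->]].
    by rewrite /comm_mx !translation_mxD addrC.
  have /orthomx_spectralP e := translation_mx_normal (C := C) g.
  have Pu := spectral_unit (translation_mx C g).
  exists (spectralmx (translation_mx C g)) => //.
  apply/diagonalizable_forPex; exists (spectral_diag (translation_mx C g)).
  by apply/simmxP => //; rewrite {2}e !mulmxA mulmxV // mul1mx.
move=> P Pu /allP D.
exists P, (fun i g => mxpoly.conjmx P (translation_mx C g) i i); split=> // g.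
have /D : translation_mx C g \in [seq translation_mx C g | g : G].
  exact: image_f.
move=> /diagonalizable_forPex [d Pd].
rewrite ((simmxP Pu) Pd); congr (diag_mx _ *m _); apply/rowP => i.
by rewrite mxE (eqP Pd) mxE eqxx.
Qed.

Definition is_character {C : numClosedFieldType} {G : finZmodType}
  (X : G -> C) : Prop := X 0 = 1 /\ {morph X : g h / g + h >-> g * h}.

(** Character values lie on the unit circle, where conjugation is inversion: this is the quotient of
    [X] by [Y]. *)
Lemma is_characterMJ {C : numClosedFieldType} {G : finZmodType}
    (X Y : G -> C) :
  is_character X -> is_character Y -> is_character (fun g => X g * (Y g)^*).
Proof.
move=> [X0 XD] [Y0 YD]; split; first by rewrite X0 Y0 conjC1 mulr1.
by move=> g h; rewrite XD YD rmorphM /= mulrACA.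
Qed.

Lemma character_norm {C : numClosedFieldType} {G : finZmodType}
    (X : G -> C) (g : G) : is_character X -> `|X g| = 1.
Proof.
move=> [X0 XD].
have XM n : X (g *+ n) = X g ^+ n.
  by elim: n => [|n IH]; rewrite ?mulr0n ?X0 // mulrS exprS XD IH.
(* The order of the group annihilates [g], so [X g] is a root of unity. *)
have : `|X g| ^+ #|G| = 1.
  rewrite -normrX -XM.
  have -> : g *+ #|G| = 0 by rewrite -cardsT; exact: (expg_cardG (in_setT g)).
  by rewrite X0 normr1.
have G_gt0 : (0 < #|G|)%N by apply/card_gt0P; exists 0.
by move/eqP; rewrite pexpr_eq1 -?lt0n // => /eqP.
Qed.

Lemma characterN {C : numClosedFieldType} {G : finZmodType}
    (X : G -> C) (g : G) : is_character X -> X (- g) = (X g)^*.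
Proof.
move=> Xc; have [X0 XD] := Xc.
have Xg : X g != 0 by rewrite -normr_gt0 character_norm.
apply: (mulfI Xg); rewrite -XD subrr X0 -normCK character_norm //.
by rewrite expr1n.
Qed.

(* The rows of P are common eigenvectors of all translations: the eigenvalues on
   each row form a character, a character determines its row up to a scalar, and
   every character occurs because P is invertible. *)
Lemma characters_exhaustive (C : numClosedFieldType) (G : finZmodType) :
  exists (P : 'M[C]_#|G|) (chi : 'I_#|G| -> G -> C), [/\ P \in unitmx,
    forall g, P *m translation_mx C g = diag_mx (\row_i chi i g) *m P,
    forall i, is_character (chi i),
    forall i j, chi i =1 chi j -> i = j
  & forall X, is_character X -> exists i, chi i =1 X].
Proof.
have [P [chi [Pu PT]]] := translation_mx_codiagonalizable C G.
have PTe i j g : P i (enum_rank (enum_val j - g)) = chi i g * P i j.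
  have := congr1 (fun M : 'M_#|G| => M i j) (PT g).
  by rewrite mul_translation_mx mul_diag_mx !mxE.
(* A row is determined by its character and its entry at 0; that entry is therefore nonzero, or the
   row of an invertible matrix would vanish. *)
have P0 i j : P i j = (chi i (- enum_val j)) * P i (enum_rank 0).
  by rewrite -PTe enum_rankK sub0r opprK enum_valK.
have rowP0 i : P i (enum_rank 0) != 0.
  apply/eqP => e.
  have : row i (P *m invmx P) = 0.
    rewrite row_mul; have -> : row i P = 0; last by rewrite mul0mx.
    by apply/rowP => j; rewrite !mxE P0 e mulr0.
  move/rowP/(_ i); rewrite mulmxV // !mxE eqxx => /eqP.
  by rewrite oner_eq0.
exists P, chi; split=> //.
- move=> i; split.
    by apply: (mulIf (rowP0 i)); rewrite -PTe enum_rankK subr0 mul1r.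
  move=> g h; apply: (mulIf (rowP0 i)); rewrite -mulrA -!PTe !enum_rankK.
  by congr (P i (enum_rank _)); rewrite !sub0r opprD addrC.
- move=> i j e; apply/eqP/negPn/negP => ij.
  (* Equal characters make rows [i] and [j] of [P] proportional; multiplying by the inverse of [P]
     would make two distinct unit vectors proportional. *)
  have : P j (enum_rank 0) *: row i (P *m invmx P) =
         P i (enum_rank 0) *: row j (P *m invmx P).
    rewrite !row_mul !scalemxAl; congr (_ *m _).
    by apply/rowP => k; rewrite !mxE !(P0 _ k) e; ring.
  move/rowP/(_ i); rewrite mulmxV // !mxE eqxx eq_sym (negbTE ij) mulr1 mulr0.
  by apply/eqP.
- move=> X [X0 XD].
  (* By the shape found in [P0], this is the common eigenvector for [X]. Any nonzero coordinate [k]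
     of it in the basis of rows of [P] forces [chi k] to equal [X]. *)
  pose v : 'rV[C]_#|G| := \row_j X (- enum_val j).
  pose w := v *m invmx P.
  have vT g : v *m translation_mx C g = X g *: v.
    apply/rowP => j; rewrite mul_translation_mx !mxE enum_rankK.
    by rewrite opprB XD.
  have [k wk] : exists k, w 0 k != 0.
    apply/rV0Pn/eqP => w0; have : w *m P = v by rewrite mulmxKV.
    rewrite w0 mul0mx => /rowP/(_ (enum_rank 0)).
    rewrite !mxE enum_rankK oppr0 X0 => /esym/eqP.
    by rewrite oner_eq0.
  exists k => g.
  have : w *m diag_mx (\row_i chi i g) = X g *: w.
    rewrite -[LHS](mulmxK Pu) -[w *m _ *m P]mulmxA -PT mulmxA /w mulmxKV //.
    by rewrite vT -scalemxAl.
  move: (w) wk => u uk; move/rowP/(_ k).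
  by rewrite mul_mx_diag !mxE [RHS]mulrC => /(mulfI uk).
Qed.

(** * The spectrum of the Cayley graph in terms of characters *)

Definition character_eigenvalue {R : rcfType} {G : finZmodType} (S : seq G)
    (X : G -> complex R) : R :=
  1 - (size S)%:R^-1 * \sum_(s <- S) complex.Re (X s).

Lemma cay_degE {G : finZmodType} (S : seq G) (u : G) : cay_deg S u = size S.
Proof.
rewrite /cay_deg /cay_edges (reindex_inj (addIr u)) /=.
under eq_bigr do rewrite addrK.
elim: S => [|s S IH] /=; first by rewrite big1.
rewrite big_split /= IH (bigD1 s) //= eqxx big1 ?addn0 // => v.
by rewrite eq_sym => /negbTE ->.
Qed.

Lemma cay_normlap_complex {R : rcfType} {G : finZmodType} (S : seq G) :
  map_mx (real_complex R) (cay_normlap R S) =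
  1%:M - (size S)%:R^-1 *: \sum_(s <- S) translation_mx (complex R) s.
Proof.
rewrite /cay_normlap map_mxB map_mx1; congr (_ - _).
apply/matrixP => i j.
rewrite !mxE !cay_degE -expr2 sqrtr_sqr ger0_norm //.
rewrite -[LHS]/(real_complex R _) rmorphM fmorphV /= !rmorph_nat mulrC; congr (_ * _).
rewrite summxE /cay_edges; elim: S => [|s S IH] /=; first by rewrite big_nil.
rewrite big_cons natrD IH mxE; congr (_%:R + _).
by rewrite [s == _]eq_sym subr_eq addrC.
Qed.

Lemma perm_symmetric_multiset {G : finZmodType} {S : seq G} :
  symmetric_multiset S -> perm_eq S [seq - s | s <- S].
Proof.
move=> symS; apply/allP => x _ /=; rewrite symS count_map; apply/eqP.
by apply: eq_count => y /=; rewrite eqr_oppLR.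
Qed.

(** Conjugation replaces each [s] by [- s], which only permutes the symmetric [S], so the sum is
    real. *)
Lemma sum_character {R : rcfType} {G : finZmodType} (S : seq G)
    (X : G -> complex R) :
  symmetric_multiset S -> is_character X ->
  \sum_(s <- S) X s = real_complex R (\sum_(s <- S) complex.Re (X s)).
Proof.
move=> symS Xc.
have : \sum_(s <- S) X s \is Num.real.
  apply/CrealP; rewrite rmorph_sum /=.
  rewrite [RHS](perm_big _ (perm_symmetric_multiset symS)).
  by rewrite big_map /=; apply: eq_bigr => s _; rewrite characterN.
move/RRe_real => <-; congr (real_complex R _).
elim: S {symS} => [|s S IH]; rewrite ?big_nil // !big_cons -IH.
by case: (X s) (\sum_(_ <- _) _) => [? ?] [].
Qed.

(** The identity is checked after embedding [R] in its complex numbers, where [P] diagonalizes the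
    Laplacian; the embedding is injective on polynomials. *)
Lemma char_poly_cay_normlap {R : rcfType} {G : finZmodType} (S : seq G)
    (P : 'M[complex R]_#|G|) (chi : 'I_#|G| -> G -> complex R) :
  symmetric_multiset S -> P \in unitmx ->
  (forall g, P *m translation_mx (complex R) g = diag_mx (\row_i chi i g) *m P) ->
  (forall i, is_character (chi i)) ->
  char_poly (cay_normlap R S) =
  \prod_(x <- [seq character_eigenvalue S (chi i) | i : 'I_#|G|]) ('X - x%:P).
Proof.
move=> symS Pu PT chi_char; apply: (map_poly_inj (real_complex R)).
rewrite map_char_poly cay_normlap_complex.
pose D := diag_mx (\row_i real_complex R (character_eigenvalue S (chi i))).
rewrite (@char_poly_conj _ _ P _ D) //.
  rewrite char_poly_trig; last exact/diag_mx_is_trig.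
  rewrite rmorph_prod /= big_map big_enum /=; apply: eq_bigr => i _.
  by rewrite map_polyXsubC !mxE eqxx.
rewrite mulmxBr mulmx1 -scalemxAr mulmx_sumr.
under eq_bigr do rewrite PT.
rewrite -mulmx_suml scalemxAl -[X in X - _]mul1mx -mulmxBl; congr (_ *m _).
apply/matrixP => i j; rewrite !mxE summxE.
under eq_bigr do rewrite !mxE.
case: eqP => [->|_]; last by rewrite !mulr0n big1 // mulr0 subr0.
under eq_bigr do rewrite mulr1n.
rewrite !mulr1n (sum_character _ _ symS) // /character_eigenvalue.
by rewrite rmorphB rmorphM fmorphV rmorph_nat rmorph1.
Qed.

Lemma size_mul_character_eigenvalue {R : rcfType} {G : finZmodType}
    (S : seq G) (X : G -> complex R) :
  (0 < size S)%N ->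
  (size S)%:R * character_eigenvalue S X = \sum_(s <- S) (1 - complex.Re (X s)).
Proof.
move=> S0; rewrite sumrB big_const_seq count_predT iter_addr_0.
rewrite /character_eigenvalue mulrBr mulr1 mulrA divff ?mul1r //.
by rewrite pnatr_eq0 -lt0n.
Qed.

Lemma character_Re_Im {R : rcfType} {G : finZmodType} (X : G -> complex R) g :
  is_character X -> complex.Re (X g) ^+ 2 + complex.Im (X g) ^+ 2 = 1.
Proof.
move=> Xc; have /(congr1 (fun z => complex.Re (z ^+ 2))) := character_norm X g Xc.
by rewrite -add_Re2_Im2 expr1n.
Qed.

Lemma character_Re_le1 {R : rcfType} {G : finZmodType} (X : G -> complex R) g :
  is_character X -> complex.Re (X g) <= 1.
Proof. move=> /(character_Re_Im X g); nra. Qed.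

Lemma sum_character_dist {R : rcfType} {G : finZmodType} (S : seq G)
    (X Y : G -> complex R) :
  (0 < size S)%N -> is_character X -> is_character Y ->
  \sum_(s <- S) ((complex.Re (X s) - complex.Re (Y s)) ^+ 2 +
                 (complex.Im (X s) - complex.Im (Y s)) ^+ 2) =
  2 * (size S)%:R * character_eigenvalue S (fun g => X g * (Y g)^*).
Proof.
move=> S0 Xc Yc; rewrite -mulrA size_mul_character_eigenvalue // mulr_sumr.
apply: eq_bigr => s _.
have := character_Re_Im X s Xc; have := character_Re_Im Y s Yc.
case: (X s) (Y s) => [a b] [c d] /= h1 h2.
lra.
Qed.

Lemma character_eigenvalue_ge0 {R : rcfType} {G : finZmodType} (S : seq G)
    (X : G -> complex R) :
  (0 < size S)%N -> is_character X -> 0 <= character_eigenvalue S X.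
Proof.
move=> S0 Xc; rewrite -(@pmulr_rge0 _ (size S)%:R) ?ltr0n //.
rewrite size_mul_character_eigenvalue // sumr_ge0 // => s _.
by rewrite subr_ge0 character_Re_le1.
Qed.

(* Equality Re X(s) = 1 throughout S forces X(s) = 1, and S generates. *)
Lemma character_eigenvalue_eq0 {R : rcfType} {G : finZmodType} (S : seq G)
    (X : G -> complex R) :
  (0 < size S)%N -> cay_connected S -> is_character X ->
  character_eigenvalue S X = 0 -> X =1 fun=> 1.
Proof.
move=> S0 conn Xc e0 g.
have := size_mul_character_eigenvalue S X S0; rewrite e0 mulr0 => /esym/eqP.
rewrite psumr_eq0 => [/allP XS1|s _]; last by rewrite subr_ge0 character_Re_le1.
have X1 s : s \in S -> X s = 1.
  move=> /XS1 /=; rewrite subr_eq0 => /eqP /esym Re1.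
  have := character_Re_Im X s Xc; rewrite Re1 expr1n => /eqP.
  rewrite -subr_eq0 addrAC subrr add0r sqrf_eq0 => /eqP Im0.
  by case: (X s) Re1 Im0 => a b /= -> ->.
have [X0 XD] := Xc.
(* Along a path from 0 to [g], each edge adds an element of [S], which multiplies the value of [X]
   by 1. *)
have /connectP [p] := conn 0 g.
elim/last_ind: p g => [|p v IH] g /=; first by move=> _ ->.
rewrite rcons_path last_rcons => /andP [pp pv] ->.
rewrite -[v](subrK (last 0 p)) XD (IH _ pp erefl) mulr1; apply: X1.
by move: pv; rewrite /cay_rel /cay_edges -has_count has_pred1.
Qed.

Lemma cay_connected_size {G : finZmodType} (S : seq G) :
  (1 < #|G|)%N -> cay_connected S -> (0 < size S)%N.
Proof.
move=> G1 conn; case: S conn => [|//] conn.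
have /card_gt0P [g] : (0 < #|[set~ (0 : G)%R]|)%N.
  by rewrite cardsC1 -subn1 subn_gt0.
rewrite in_setC1 => g0; have /connectP [[|v p] /=] := conn 0 g => //.
by move=> _ e; rewrite e eqxx in g0.
Qed.

(** * The bound on the threshold rank *)

Theorem theorem1p3 (R : realType) :
  exists C : R, 0 < C /\
  forall (Gamma : finZmodType) (S : seq Gamma),
    (1 < #|Gamma|)%N ->
    symmetric_multiset S ->
    cay_connected S ->
    forall tau : R, lambda R S 2 <= tau -> tau <= 3 / 2 ->
      (mul_tau R S tau)%:R <= (C * tau / lambda R S 2) ^+ (20 * size S).
Proof.
exists 24; split=> // G S G1 symS conn tau lam_tau _.
have S0 := cay_connected_size S G1 conn.
have [P [chi [Pu PT chi_char chi_inj chi_all]]] :=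
  characters_exhaustive (complex R) G.
pose ev i : R := character_eigenvalue S (chi i).
have eigs : perm_eq (eigenvalues (cay_normlap R S)) [seq ev i | i : 'I_#|G|].
  exact/eigenvalues_perm/(char_poly_cay_normlap S P).
have triv : is_character (fun _ : G => 1 : complex R).
  by split=> // g h; rewrite mulr1.
have [i0 chi0] := chi_all _ triv.
have ev0 : ev i0 = 0.
  rewrite /ev /character_eigenvalue; under eq_bigr do rewrite chi0.
  rewrite /= big_const_seq count_predT iter_addr_0 mulVf ?subrr //.
  by rewrite pnatr_eq0 -lt0n.
have ev_gt0 i : i != i0 -> 0 < ev i.
  move=> ii0; rewrite lt_def character_eigenvalue_ge0 // andbT.
  apply: contraNneq ii0 => /(character_eigenvalue_eq0 S _ S0 conn (chi_char i)) e.
  by apply/eqP/chi_inj => g; rewrite e chi0.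
(* The spectrum without the trivial character; removing an index instead of a value keeps all other
   multiplicities. *)
pose s := [seq ev i | i <- rem i0 (enum 'I_#|G|)].
have mem_s i : i != i0 -> ev i \in s.
  by move=> ii0; rewrite map_f // mem_rem_uniq ?enum_uniq // inE ii0 mem_enum.
have eigs0 : perm_eq (eigenvalues (cay_normlap R S)) (0 :: s).
  apply: (perm_trans eigs); rewrite -ev0 -[_ :: s]/[seq ev i | i <- i0 :: rem i0 _].
  by apply/perm_map/perm_to_rem; rewrite mem_enum.
have s_gt0 : all (> 0) s.
  rewrite all_map; apply/allP => i; rewrite mem_rem_uniq ?enum_uniq // inE.
  by case/andP => ii0 _; exact: ev_gt0.
(* A second eigenvalue exists because the group is nontrivial, so [lambda R S 2] is not the default
   value of [nth]. *)
have s_neq0 : s != [::].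
  by rewrite -size_eq0 size_map size_rem ?mem_enum // size_enum_ord; lia.
have [lam_in lam_le] :=
  sorted_cons_nth1 _ _ (eigenvalues_sorted _) eigs0 s_gt0 s_neq0.
have lam_gt0 : 0 < lambda R S 2 by exact: (allP s_gt0).
pose q := tau / lambda R S 2.
have q1 : 1 <= q by rewrite ler_pdivlMr // mul1r.
pose A := [set i | ev i <= tau].
have -> : mul_tau R S tau = #|A|.
  rewrite /mul_tau (permP eigs) count_map enumT cardE size_filter.
  by apply: eq_count => i /=; rewrite inE.
pose root_lam := Num.sqrt (lambda R S 2).
have root_sq (a : R) : (a / root_lam) ^+ 2 = a ^+ 2 / lambda R S 2.
  by rewrite expr_div_n sqr_sqrtr // ltW.
(* Coordinates are indexed by positions in [S], to respect multiplicities. The center [(1, ..., 1)]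
   is moved to the origin, and dividing by the root of [lambda_2] makes the squared separation [2d],
   the number of coordinates. *)
pose pt i (kb : 'I_(size S) * bool) : R :=
  (let z := chi i (nth 0 S kb.1) in
   if kb.2 then complex.Re z - 1 else complex.Im z) / root_lam.
have sum_pt (a : 'I_(size S) * bool -> R) (F : G -> R) :
    (forall k, a (k, true) ^+ 2 + a (k, false) ^+ 2 =
               F (nth 0 S k) / lambda R S 2) ->
    \sum_kb a kb ^+ 2 = (\sum_(g <- S) F g) / lambda R S 2.
  move=> aF; have -> : \sum_kb a kb ^+ 2 = \sum_k \sum_b a (k, b) ^+ 2.
    by rewrite pair_bigA; apply: eq_bigr => -[].
  rewrite (big_nth 0) big_mkord mulr_suml; apply: eq_bigr => k _.
  by rewrite big_bool; exact: aF.
have card_I : #|{: 'I_(size S) * bool}| = (size S * 2)%N.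
  by rewrite card_prod card_ord card_bool.
(* The count gives exponent [2d]; since the base is at least 1, it may be raised to [20d]. *)
apply: (@le_trans _ _ ((24 * q) ^+ (size S * 2))); last first.
  rewrite -mulrA -/q; apply: ler_weXn2l; last by lia.
  by lra.
rewrite -card_I; apply: (@card_separated_le _ _ _ A pt) => //.
- by rewrite card_I; lia.
- move=> i; rewrite inE => ev_tau.
  rewrite (sum_pt _ (fun g => 2 * (1 - complex.Re (chi i g)))) => [|k].
    rewrite -mulr_sumr -size_mul_character_eigenvalue // card_I /q.
    rewrite mulrA ler_pM2r ?invr_gt0 // natrM mulrCA mulrA ler_wpM2l //.
    by rewrite mulr_ge0.
  rewrite /pt /= !root_sq -mulrDl; congr (_ / _).
  have := character_Re_Im _ (nth 0 S k) (chi_char i).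
  lra.
- move=> i j _ _ ij.
  rewrite (sum_pt (fun kb => pt i kb - pt j kb) (fun g =>
    (complex.Re (chi i g) - complex.Re (chi j g)) ^+ 2 +
    (complex.Im (chi i g) - complex.Im (chi j g)) ^+ 2)) => [|k].
    have XY := is_characterMJ _ _ (chi_char i) (chi_char j).
    rewrite sum_character_dist //; have [k chik] := chi_all _ XY.
    have -> : character_eigenvalue S (fun g => chi i g * (chi j g)^* ) = ev k.
      rewrite /ev /character_eigenvalue.
      by under [in RHS]eq_bigr do rewrite chik.
    rewrite card_I natrM -[leRHS]mulrA [2 * _]mulrC ler_peMr ?mulr_ge0 //.
    rewrite ler_pdivlMr // mul1r lam_le // mem_s //.
    (* If the quotient character were trivial, multiplying it by [chi j], of modulus 1, would give
       [chi i = chi j]. *)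
    apply: contraNneq ij => kk; apply/eqP/chi_inj => g.
    have := chik g; rewrite kk chi0 /= => e.
    have norm_j := character_norm _ g (chi_char j).
    rewrite -[LHS]mulr1 -[1 in LHS](expr1n _ 2) -norm_j normCK.
    by rewrite [chi j g * _]mulrC mulrA -e mul1r.
  rewrite /pt /= -!mulrBl !root_sq -mulrDl; congr (_ / _).
  ring.
Qed.
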